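(* Let $f:\mathbb{R}^3\to\mathbb{R}$ be a $C^4$ smooth regular map, i.e. $\nabla f(\mathbf{X})\neq 0$ for every $\mathbf{X}\in\mathcal{M}$, where $\mathcal{M}=\{\mathbf{X}\in\mathbb{R}^3 : f(\mathbf{X})=0\}$. Let $h:\mathbb{R}\to\mathbb{R}$ be a smooth function with $h(0)=0$, and let the external force $\mathbf{F}$ be given by $$\mathbf{F}(\mathbf{X},\mathbf{T})= a\,\frac{\mathbf{T}^\top \nabla^2 f(\mathbf{X})\,\mathbf{T} + h(f(\mathbf{X}))}{|\nabla f(\mathbf{X})|^2}\,\nabla f(\mathbf{X}),\qquad \mathbf{T}=\partial_s\mathbf{X},\quad a=a(\mathbf{X},\mathbf{T}).$$ Let $\Gamma_t=\{\mathbf{X}(u,t): u\in I\}$, $t\ge 0$, be a family of closed curves evolving according to the geometric equation $$\partial_t\mathbf{X} = a\,\partial_s^2\mathbf{X} + \mathbf{F}(\mathbf{X},\partial_s\mathbf{X})+\alpha\,\partial_s\mathbf{X}.$$ If the initial curve satisfies $\Gamma_0\subset\mathcal{M}$, then $\Gamma_t\subset\mathcal{M}$ for all $t>0$ (for which the evolution is defined). Furthermore, the tangential velocity satisfies $v_T=\alpha$.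
   Context: $I=\mathbb{R}/\mathbb{Z}\simeq S^1$. The closed curves $\Gamma_t$ are parametrized by a smooth map $\mathbf{X}=\mathbf{X}(u,t)$, $u\in I$, with values in $\mathbb{R}^3$ and $|\partial_u\mathbf{X}|>0$. The arc-length parameter $s$ is defined by $ds=|\partial_u\mathbf{X}|\,du$, i.e. $\partial_s=|\partial_u\mathbf{X}|^{-1}\partial_u$, and $\mathbf{T}=\partial_s\mathbf{X}$ is the unit tangent vector. The coefficient $a=a(\mathbf{X},\partial_s\mathbf{X})>0$ is a bounded smooth function of its arguments, and $\mathbf F$ is bounded and smooth along the evolving curves (in particular $\nabla f\ne0$ along them, so that $\mathbf F$ is defined). The function $\alpha=\alpha(u,t)$ is a smooth scalar function. The tangential velocity is $v_T=(\partial_t\mathbf{X})^\top\mathbf{T}=\mathbf{F}^\top\mathbf{T}+\alpha$. $\nabla^2 f$ denotes the Hessian matrix of $f$. *)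

(* Defs.v *)
From mathcomp Require Import all_boot all_order all_algebra.
From mathcomp Require Import all_classical all_reals all_analysis.
Set Implicit Arguments.
Unset Strict Implicit.
Unset Printing Implicit Defensive.
Import Order.TTheory GRing.Theory Num.Theory.
Import numFieldNormedType.Exports.
Local Open Scope classical_set_scope.
Local Open Scope ring_scope.

Section Smoothness.
Context {R : realType} {V W : normedModType R}.

(* Class C^n on an open set U.  V is meant to be finite-dimensional: there,
   existence and continuity of all iterated directional derivatives up to
   order n is the usual notion. *)
Fixpoint Ck (n : nat) (U : set V) (g : V -> W) : Prop :=
  match n with
  | 0%N => forall x, U x -> {for x, continuous g}
  | m.+1 => (forall x, U x -> differentiable g x) /\
            (forall v, Ck m U (fun x => 'D_v g x))
  end.

(* Smoothness on an arbitrary set S, in the usual sense: near each of its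
   points, g is the restriction to S of a C^infinity map defined on an open
   set.  Only the values of g on S matter. *)
Definition smooth_on (S : set V) (g : V -> W) : Prop :=
  forall x, S x -> exists (U : set V) (g' : V -> W),
    [/\ open U, U x, forall n, Ck n U g' &
        forall y, U y -> S y -> g' y = g y].

End Smoothness.

Section Euclidean.
Context {R : realType} {n : nat}.
Implicit Types (x p : 'cV[R]_n) (f : 'cV[R]_n -> R).

Definition dotv x p : R := (x^T *m p) 0 0.

(* The library norm `|x| of a column vector is the maximum norm. *)
Definition enorm x : R := Num.sqrt (dotv x x).

Definition grad f x : 'cV[R]_n := \col_i 'D_(delta_mx i 0) f x.

Definition hess f x : 'M[R]_n :=
  \matrix_(i, j) 'D_(delta_mx i 0) (fun y => 'D_(delta_mx j 0) f y) x.

Definition force f (h : R -> R) (a : 'cV[R]_n -> 'cV[R]_n -> R) x p :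
    'cV[R]_n :=
  (a x p * (((p^T *m hess f x *m p) 0 0 + h (f x)) / enorm (grad f x) ^+ 2))
    *: grad f x.

End Euclidean.

Section Curves.
Context {R : realType}.

(* d/ds of g along the parametrized curve c, where ds = |c'(u)| du. *)
Definition arcderiv n (c : R -> 'cV[R]_n) (V : normedModType R) (g : R -> V)
  (u : R) : V := (enorm (derive1 c u))^-1 *: derive1 g u.

Definition tangent n (c : R -> 'cV[R]_n) : R -> 'cV[R]_n := arcderiv c c.

(* Derivative at t of g restricted to J; one-sided when t is an end point of
   the interval J. *)
Definition deriv_within (J : set R) (V : normedModType R) (g : R -> V)
  (t : R) : V := lim ((s - t)^-1 *: (g s - g t) @[s --> within J t^']).

(* X u t is the point of parameter u at time t. *)
Definition trace n (X : R -> R -> 'cV[R]_n) (t : R) : set 'cV[R]_n :=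
  [set X u t | u in [set: R]].

Definition tangential_velocity n (J : set R) (X : R -> R -> 'cV[R]_n)
  (u t : R) : R := dotv (deriv_within J (X u) t) (tangent (X^~ t) u).

End Curves.

(* Main.v *)
Require Import Defs.
From mathcomp Require Import all_boot all_order all_algebra.
From mathcomp Require Import all_classical all_reals all_analysis.
From mathcomp Require Import ring lra.
Set Implicit Arguments.
Unset Strict Implicit.
Unset Printing Implicit Defensive.
Import Order.TTheory GRing.Theory Num.Theory.
Import numFieldNormedType.Exports.
Local Open Scope classical_set_scope.
Local Open Scope ring_scope.

(** Write phi u t = f (X u t) for the level of the moving point, T for the unit
    tangent and s for arc length.  The chain rule gives d phi/ds = grad f . T
    and d^2 phi/ds^2 = T^T (hess f) T + grad f . dT/ds
    ([is_derive_value_along], [is_derive_tangential_slope]).  The force is the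
    multiple of grad f for which grad f . F = a (T^T (hess f) T + h phi)
    ([dotv_grad_force]), so taking the scalar product of the evolution equation
    with grad f yields a scalar equation for phi ([level_evolution]):
      d phi/dt = a d^2 phi/ds^2 + a h(phi) + alpha d phi/ds.
    This is a parabolic equation of which 0 is a solution since h 0 = 0, and phi
    vanishes initially; it remains to see that phi stays 0.

    On a compact time interval [0, t0] the level is bounded, by periodicity in
    u, so |h(phi)| <= L |phi| there ([linear_growth]).  At a spatial maximum of phi
    one has d phi/ds = 0 and d^2 phi/ds^2 <= 0 ([max_first_second_order]), hence
    d phi/dt <= C L phi wherever this maximum is positive, C being a bound of a.
    Such an inequality keeps phi <= 0 ([weak_maximum_principle]): otherwise
    phi exp(-(C L + 1) t) would have a positive maximum over a period times
    [0, t0], at which its time derivative is both nonnegative and negative.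
    The same argument applies to - phi, so phi = 0.

    Once phi = 0, also grad f . T = d phi/ds = 0, so the force is normal to the
    curve; dT/ds is normal too because |T| = 1 ([curvature_orthogonal]), and
    only alpha T contributes to the tangential velocity.

    Since X is only given on times in J, time derivatives are computed on a
    smooth local extension of X beyond J; it has the same derivative as X within
    J because J accumulates at each of its points ([deriv_withinE]). *)

(** * Scalar product and the normal force *)

Section DotProduct.
Context {R : realType} {n : nat}.
Implicit Types (x p : 'cV[R]_n) (f : 'cV[R]_n -> R).

Lemma dotvE x p : dotv x p = \sum_i x i 0 * p i 0.
Proof. by rewrite /dotv mxE; apply: eq_bigr => i _; rewrite mxE. Qed.

Lemma dotvC x p : dotv x p = dotv p x.
Proof. by rewrite !dotvE; apply: eq_bigr => i _; rewrite mulrC. Qed.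

Lemma dotvDr x p q : dotv x (p + q) = dotv x p + dotv x q.
Proof. by rewrite /dotv mulmxDr mxE. Qed.

Lemma dotvZr k x p : dotv x (k *: p) = k * dotv x p.
Proof. by rewrite /dotv -scalemxAr mxE. Qed.

Lemma dotvDl x p q : dotv (p + q) x = dotv p x + dotv q x.
Proof. by rewrite !(dotvC _ x) dotvDr. Qed.

Lemma dotvZl k x p : dotv (k *: p) x = k * dotv p x.
Proof. by rewrite !(dotvC _ x) dotvZr. Qed.

Lemma dotv_ge0 x : 0 <= dotv x x.
Proof. by rewrite dotvE sumr_ge0// => i _; rewrite -expr2 sqr_ge0. Qed.

Lemma sqr_enorm x : enorm x ^+ 2 = dotv x x.
Proof. by rewrite sqr_sqrtr// dotv_ge0. Qed.

Lemma dotv_neq0 x : x <> 0 -> dotv x x != 0.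
Proof.
move=> x0; apply/eqP => /eqP; rewrite dotvE psumr_eq0; last first.
  by move=> i _; rewrite -expr2 sqr_ge0.
move=> /allP x2; apply: x0; apply/matrixP => i j; rewrite ord1 mxE.
by have := x2 i (mem_index_enum _); rewrite mulf_eq0 orbb => /eqP.
Qed.

(** The denominator of the force is chosen to cancel here.  The Hessian appears
    transposed to match [is_derive_grad_along]. *)
Lemma dotv_grad_force h a f x p : grad f x <> 0 ->
  dotv (grad f x) (force f h a x p) =
  a x p * (dotv ((hess f x)^T *m p) p + h (f x)).
Proof.
move=> /dotv_neq0 g0; rewrite /force dotvZr sqr_enorm -!mulrA mulVf// mulr1.
by rewrite /dotv trmx_mul trmxK.
Qed.

End DotProduct.

(** * Differentiation along curves *)

Section CurveDerivatives.
Context {R : realType}.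

Lemma is_derive_coord {V : normedModType R} {m n} (M : V -> 'M[R]_(m, n)) t v
    dM i j :
  is_derive t v M dM -> is_derive t v (fun x => M x i j) (dM i j).
Proof.
move=> [Mt <-]; apply: DeriveDef; first by move/derivable_mxP : Mt; exact.
by rewrite derive_mx// mxE.
Qed.

Lemma is_derive_mx {V : normedModType R} {m n} (M : V -> 'M[R]_(m, n)) t v
    (dM : 'M[R]_(m, n)) :
  (forall i j, is_derive t v (fun x => M x i j) (dM i j)) -> is_derive t v M dM.
Proof.
move=> MdM; have Mt : derivable M t v.
  by apply/derivable_mxP => i j; have [] := MdM i j.
apply: DeriveDef => //; rewrite derive_mx//; apply/matrixP => i j.
by rewrite mxE; have [] := MdM i j.
Qed.

Context {n : nat}.
Implicit Types (c b : R -> 'cV[R]_n) (f : 'cV[R]_n -> R) (t : R).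
Implicit Types dc db v : 'cV[R]_n.

Lemma is_derive_dotv c b t dc db :
  is_derive t 1 c dc -> is_derive t 1 b db ->
  is_derive t 1 (fun s => dotv (c s) (b s)) (dotv dc (b t) + dotv (c t) db).
Proof.
move=> cdc bdb.
rewrite (_ : (fun s => _) =
  \sum_i ((fun s => c s i 0) * (fun s => b s i 0))); last first.
  by apply/funext => s; rewrite dotvE fct_sumE.
have ? i := is_derive_coord i 0 cdc.
have ? i := is_derive_coord i 0 bdb.
apply: is_derive_eq.
rewrite !dotvE -big_split/=; apply: eq_bigr => i _.
by rewrite /GRing.scale/= addrC; congr (_ + _); rewrite mulrC.
Qed.

Lemma is_derive_scalev (k : R -> R) c t dk dc :
  is_derive t 1 k dk -> is_derive t 1 c dc ->
  is_derive t 1 (fun s => k s *: c s) (dk *: c t + k t *: dc).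
Proof.
move=> kdk cdc; apply: is_derive_mx => i j.
rewrite (_ : (fun s => _) = k * (fun s => c s i j)); last first.
  by apply/funext => s; rewrite !mxE.
have ? := is_derive_coord i j cdc.
by apply: is_derive_eq; rewrite !mxE /GRing.scale/= addrC (mulrC dk).
Qed.

Lemma diff_grad f x v : differentiable f x -> 'd f x v = dotv (grad f x) v.
Proof.
move=> fx; rewrite [v in LHS]matrix_sum_delta linear_sum dotvE.
apply: eq_bigr => i _; rewrite big_ord1 linearZ mxE deriveE//=.
by rewrite /GRing.scale/= mulrC.
Qed.

Lemma is_derive_along c f t dc :
  is_derive t 1 c dc -> differentiable f (c t) ->
  is_derive t 1 (f \o c) (dotv (grad f (c t)) dc).
Proof.
move=> [ct <-] fc; have /derivable1_diffP dct := ct.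
apply: DeriveDef; first by apply/derivable1_diffP; exact: differentiable_comp.
rewrite deriveE; last exact: differentiable_comp.
by rewrite (diff_comp dct fc)/= diff_grad// (deriveE _ dct).
Qed.

(** With the convention hess f i j = D_i (D_j f), the j-th component
    of grad f varies along c at the rate sum_i (hess f i j) c_i': this is
    the transpose of the Hessian acting on c'. *)
Lemma is_derive_grad_along c f t dc :
  is_derive t 1 c dc ->
  (forall v, differentiable (fun x => 'D_v f x) (c t)) ->
  is_derive t 1 (grad f \o c) ((hess f (c t))^T *m dc).
Proof.
move=> cdc fc; apply: is_derive_mx => j k.
rewrite (_ : (fun s => _) = (fun x => 'D_(delta_mx j 0) f x) \o c); last first.
  by apply/funext => s /=; rewrite !mxE.
apply: is_derive_eq; first exact: is_derive_along cdc (fc _).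
by rewrite (ord1 k) dotvE !mxE; apply: eq_bigr => i _; rewrite !mxE.
Qed.

End CurveDerivatives.

Section Tangent.
Context {R : realType} {n : nat}.
Variable c : R -> 'cV[R]_n.
Hypothesis c_immersed : forall u, 0 < enorm (derive1 c u).

Lemma derive1_tangent u : derive1 c u = enorm (derive1 c u) *: tangent c u.
Proof. by rewrite /tangent /arcderiv scalerA divff ?scale1r// gt_eqF. Qed.

Lemma enorm_tangent u : enorm (tangent c u) = 1.
Proof.
rewrite /enorm /tangent /arcderiv dotvZl dotvZr mulrA -expr2 -sqr_enorm.
by rewrite -exprMn mulVf ?gt_eqF// expr1n sqrtr1.
Qed.

Hypothesis ddc : forall u : R, derivable (derive1 c) u 1.

Lemma derivable_tangent (u : R) : derivable (tangent c) u 1.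
Proof.
have d0 : 0 < dotv (derive1 c u) (derive1 c u) by rewrite -sqr_enorm exprn_gt0.
have sq := is_derive_dotv (derivableP (@ddc u)) (derivableP (@ddc u)).
have ec := is_derive1_comp (is_derive1_sqrt d0) sq.
have iec := @is_deriveV _ (enorm \o derive1 c) _ _ _
  (lt0r_neq0 (c_immersed u)) ec.
by have [] := is_derive_scalev iec (derivableP (@ddc u)).
Qed.

(** Differentiate T . T = 1. *)
Lemma curvature_orthogonal u :
  dotv (arcderiv c (tangent c) u) (tangent c u) = 0.
Proof.
have Tu := derivableP (@derivable_tangent u).
have [_] := is_derive_dotv Tu Tu.
rewrite (_ : (fun s => _) = cst (1 : R)); last first.
  by apply/funext => s; rewrite -sqr_enorm enorm_tangent expr1n.
rewrite derive_cst (dotvC (tangent c u)) => DTT.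
have TDT : dotv ('D_(1:R) (tangent c) u) (tangent c u) = 0 by lra.
by rewrite {1}/arcderiv dotvZl (derive1E (tangent c)) TDT mulr0.
Qed.

End Tangent.

(** * Derivatives at a maximum *)

Section Extrema.
Context {R : realType}.
Implicit Types (g p q : R -> R) (t d e : R).

(** By Caratheodory, the difference quotient extends to a function that is
    continuous at [t] with value [d]; one neighbourhood thus serves on both
    sides of [t]. *)
Lemma slope_gt0_near g t d : is_derive t 1 g d -> 0 < d ->
  exists2 e, 0 < e &
    forall s, `|s - t| < e -> s != t -> 0 < (g s - g t) / (s - t).
Proof.
move=> /is_derive1_caratheodory[k [gE kt kE]] d0.
have : \forall s \near t, 0 < k s.
  by have := lt_nbhsr d0; rewrite -kE; exact: kt.
move=> /nbhs_ballP[e /= e0 ek]; exists e => // s st sNt.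
rewrite gE mulfK ?subr_eq0//; apply: ek.
by rewrite /ball/= distrC.
Qed.

(** Only times before [t] are compared, as the maximum over [0, t0] may be
    attained at the final time. *)
Lemma left_max_derive_ge0 g t d e : is_derive t 1 g d -> 0 < e ->
  (forall s, t - e < s -> s < t -> g s <= g t) -> 0 <= d.
Proof.
move=> gd e0 gmax; rewrite leNgt; apply/negP => d0.
have [r r0 gt] := slope_gt0_near (is_deriveN gd) (etrans (oppr_gt0 d) d0).
pose s := t - Num.min r e / 2.
have m0 : 0 < Num.min r e by rewrite lt_min r0.
have mr : Num.min r e <= r by rewrite ge_min lexx.
have me : Num.min r e <= e by rewrite ge_min lexx orbT.
have st : s < t by rewrite /s; lra.
have := gt s; rewrite ltr0_norm ?subr_lt0//.
have := gmax s; rewrite /s.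
set m := Num.min r e in s m0 mr me st *.
rewrite fctE => gm /(_ _ _) k.
have : 0 < (- g s + g t) / (s - t).
  by rewrite -{1}[g t]opprK; apply: k; rewrite /s; [lra|apply/eqP; lra].
rewrite ltNge ler_ndivrMr ?subr_lt0// mul0r addrC subr_ge0.
by rewrite gm// /s; lra.
Qed.

(** First and second order conditions at a maximum in a parametrization of
    speed [q]: here [g] is the arc-length derivative of [p], and [d] is, up to
    the factor [q t], its second arc-length derivative.  Stating them with [g]
    rather than with the second derivative of [p] avoids differentiating [q].
    If [d] were positive, then [g], which vanishes at [t], would be positive
    just after [t] and [p] would increase there. *)
Lemma max_first_second_order p q g t d :
  (forall s : R, is_derive s 1 p (q s * g s)) -> (forall s, 0 < q s) ->
  is_derive t 1 g d -> (forall s, p s <= p t) -> g t = 0 /\ d <= 0.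
Proof.
move=> dp q0 gd pmax.
have gt0 : g t = 0.
  have pt : is_derive t 1 p 0.
    apply: (@derive1_at_max _ p (t - 1) (t + 1)) => //; first lra.
      by rewrite in_itv/=; lra.
  have := @derive_val _ _ _ _ _ _ _ (dp t); rewrite derive_val => /esym/eqP.
  by rewrite mulf_eq0 gt_eqF//= => /eqP.
split=> //; rewrite leNgt; apply/negP => d0.
have [e e0 ge] := slope_gt0_near gd d0.
have te : t < t + e / 2 by lra.
have [|s] := MVT te (fun s _ => dp s).
  by apply: derivable_within_continuous => s _; have [] := dp s.
rewrite in_itv/= => /andP[ts se].
have gs : 0 < g s.
  have := ge s; rewrite gt0 subr0 gtr0_norm ?subr_gt0// => /(_ _ _).
  rewrite pmulr_lgt0 ?invr_gt0 ?subr_gt0//; apply; first lra.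
  by rewrite gt_eqF.
have := pmax (t + e / 2).
have : 0 < q s * g s * (t + e / 2 - t) by rewrite !mulr_gt0//; lra.
lra.
Qed.

End Extrema.

(** * A weak maximum principle *)

Section WeakMaximumPrinciple.
Context {R : realType}.

Lemma periodic_unit_interval (g : R -> R) u : periodic g 1 ->
  exists2 v, 0 <= v <= 1 & g v = g u.
Proof.
move=> pg; have /andP[fu uf] := floor_itv u.
rewrite intrD in uf.
exists (u - (Num.floor u)%:~R); first by apply/andP; split; lra.
case: (Num.floor u) => n.
  by rewrite -[in RHS](subrK (n%:R) u) -(periodicn pg n).
rewrite -(periodicn pg n.+1 u); congr g.
by rewrite NegzE intrN opprK.
Qed.

(** The differential inequality is only required at positive spatial maxima,
    which frees the statement from any particular parabolic operator.  The time
    derivative is that of some function [th] agreeing with phi up to time t,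
    because phi need not be differentiable, nor even meaningful, after the final
    time.  The weight decays at rate lam + 1, faster than the growth that the
    inequality allows, which makes the weighted derivative strictly negative. *)
Lemma weak_maximum_principle (phi : R -> R -> R) (t0 lam : R) :
  (forall t : R, 0 <= t <= t0 -> periodic (phi^~ t) 1) ->
  {within `[0, 1] `*` `[0, t0], continuous (fun p : R * R => phi p.1 p.2)} ->
  (forall u, phi u 0 <= 0) ->
  (forall u t : R, 0 < t <= t0 -> 0 < phi u t ->
     (forall v, phi v t <= phi u t) ->
     exists th d, [/\ is_derive t 1 th d,
       \forall s \near t, 0 <= s <= t -> th s = phi u s &
       d <= lam * phi u t]) ->
  forall u t : R, 0 <= t <= t0 -> phi u t <= 0.
Proof.
move=> per phic ini crit u t tt0; rewrite leNgt; apply/negP => put.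
have /andP[t_ge0 t_le] := tt0.
pose w (p : R * R) := phi p.1 p.2 * expR (- (lam + 1) * p.2).
have [||//|] := @compact_EVT_max _ _ w (`[0, 1] `*` `[0, t0]).
- by exists (0, t); rewrite /= !in_itv/= lexx ler01 t_ge0.
- by apply: compact_setX; exact: segment_compact.
- apply/subspace_continuousP => p pK; apply: cvgM.
    by move/subspace_continuousP : phic; exact.
  apply: cvg_within_filter; apply: continuous_comp; last exact: continuous_expR.
  by apply: cvgM; [exact: cvg_cst|exact: cvg_snd].
move=> [u1 t1]; rewrite inE/= !in_itv/= => -[u1I t1I] wmax.
(* periodicity makes the maximum over one period a maximum over all v *)
have wmaxT (v s : R) : 0 <= s <= t0 -> w (v, s) <= w (u1, t1).
  move=> sI; have [v' v'I v'v] := periodic_unit_interval v (per s sI).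
  have := wmax (v', s); rewrite inE/= !in_itv/= /w/= v'v; exact.
have p1 : 0 < phi u1 t1.
  have : 0 < w (u1, t1).
    by rewrite (lt_le_trans _ (wmaxT u t tt0))// mulr_gt0 ?expR_gt0.
  by rewrite /w/= pmulr_lgt0 ?expR_gt0.
have /andP[t1_ge0 t1_le] := t1I.
have t1_gt0 : 0 < t1.
  rewrite lt_neqAle t1_ge0 andbT; apply/eqP => t10.
  by move: p1; rewrite -t10 ltNge ini.
have [|v|th [d [thd thphi dle]]] := crit u1 t1 _ p1.
- by rewrite t1_gt0.
- by have := wmaxT v t1 t1I; rewrite /w/= ler_pM2r ?expR_gt0.
have {thphi} [e /= e0 eth] :
  \forall s \near t1, 0 <= s <= t1 -> th s = phi u1 s by [].
have th1 : th t1 = phi u1 t1.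
  by apply: eth => /=; rewrite ?subrr ?normr0// t1_ge0 lexx.
have lin : is_derive t1 1 (fun s => - (lam + 1) * s) (- (lam + 1)).
  by apply: is_derive_eq; rewrite /GRing.scale/= mulr1.
have ex := is_derive1_comp (is_derive_expR _) lin.
have W := is_deriveM thd ex.
have : 0 <= expR (- (lam + 1) * t1) * (phi u1 t1 * - (lam + 1) + d).
  have e1 : 0 < Num.min e t1 by rewrite lt_min e0.
  have := left_max_derive_ge0 W e1.
  rewrite th1 /GRing.scale/= mulrDr (mulrCA (phi u1 t1)); apply=> s se st.
  have s0 : 0 <= s by rewrite (le_trans _ (ltW se))// subr_ge0 ge_min lexx orbT.
  rewrite !fctE/= th1 eth; last first.
  - by rewrite s0 ltW.
  - have me : Num.min e t1 <= e by rewrite ge_min lexx.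
    by rewrite /= gtr0_norm ?subr_gt0//; lra.
  by apply: (wmaxT u1 s); rewrite s0 (le_trans (ltW st)).
by rewrite pmulr_rge0 ?expR_gt0//; nra.
Qed.

End WeakMaximumPrinciple.

(** * Space and time slices of a map that is smooth on a set *)

Section Slices.
Context {R : realType} {W : normedModType R}.

Lemma smooth_on_within_continuous {V : normedModType R} (S : set V)
    (g : V -> W) :
  smooth_on S g -> {within S, continuous g}.
Proof.
move=> gS; apply/subspace_continuousP => x Sx.
have [U [G [oU Ux /(_ 0%N x Ux) Gx GE]]] := gS x Sx.
have : G y @[y --> within S (nbhs x)] --> G x by exact: cvg_within_filter.
rewrite (GE x Ux Sx).
apply: cvg_trans; apply: near_eq_cvg; rewrite near_withinE.
near=> y => Sy; apply: GE => //.
by near: y; exact: open_nbhs_nbhs.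
Unshelve. all: by end_near. Qed.

Lemma is_derive_slice1 (G : R * R -> W) (u t : R) d :
  is_derive (u, t) (1, 0) G d -> is_derive u 1 (fun v => G (v, t)) d.
Proof.
have E : (fun h : R => h^-1 *: ((G \o shift (u, t)) (h *: (1, 0)) - G (u, t))) =
    (fun h : R => h^-1 *: (((fun v => G (v, t)) \o shift u) h%:A - G (u, t))).
  by apply/funext => h /=; rewrite /GRing.add/= /add_pair/= scaler0 add0r.
by move=> [Gd Gv]; apply: DeriveDef; [move: Gd; rewrite /derivable E|
  move: Gv; rewrite /derive E].
Qed.

Lemma is_derive_slice2 (G : R * R -> W) (u t : R) d :
  is_derive (u, t) (0, 1) G d -> is_derive t 1 (fun s => G (u, s)) d.
Proof.
have E : (fun h : R => h^-1 *: ((G \o shift (u, t)) (h *: (0, 1)) - G (u, t))) =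
    (fun h : R => h^-1 *: (((fun s => G (u, s)) \o shift t) h%:A - G (u, t))).
  by apply/funext => h /=; rewrite /GRing.add/= /add_pair/= scaler0 add0r.
by move=> [Gd Gv]; apply: DeriveDef; [move: Gd; rewrite /derivable E|
  move: Gv; rewrite /derive E].
Qed.

Variables (J : set R) (X : R -> R -> W).
Hypothesis X_smooth : smooth_on [set p : R * R | J p.2] (fun p => X p.1 p.2).

(** At a fixed time in J a local extension agrees with X for all nearby
    parameters, so that slices in u are differentiable in the ordinary sense. *)
Lemma smooth_slice1 (u t : R) : J t ->
  derivable (X^~ t) u 1 /\ derivable (derive1 (X^~ t)) u 1.
Proof.
move=> Jt.
have [U [G [oU Ut /(_ 2%N)[dG /(_ (1, 0))[ddG _]] GE]]] :=
  X_smooth (x := (u, t)) Jt.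
have nU : \forall v \near u, U (v, t).
  have [[A B] /= [Au Bt] ABU] : nbhs (u, t) U by exact: open_nbhs_nbhs.
  by near=> v; apply: ABU; split => /=; [near: v|exact: nbhs_singleton].
have eX : \forall v \near u, G (v, t) = X v t.
  by near=> v; apply: GE => //; near: v.
have dX v : U (v, t) -> is_derive v 1 (fun v => G (v, t)) ('D_(1, 0) G (v, t)).
  move=> Uv; exact: is_derive_slice1 (derivableP (diff_derivable (dG _ Uv))).
split.
  apply: near_eq_derivable eX _.
  by have [] := dX u Ut.
have eD : \forall v \near u, 'D_(1, 0) G (v, t) = derive1 (X^~ t) v.
  near=> v; rewrite derive1E.
  have [|_ <-] := dX v; first by near: v.
  apply: near_eq_derive; near: v.
  exact: near_join eX.
apply: near_eq_derivable eD _.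
by have [] := is_derive_slice1 (derivableP (diff_derivable (ddG _ Ut))).
Unshelve. all: by end_near. Qed.

(** At a fixed parameter X itself may fail to be differentiable in time at an
    end point of J, whence the extension [c]. *)
Lemma smooth_slice2 (u t : R) : J t ->
  exists2 c : R -> W, derivable c t 1 & \forall s \near t, J s -> c s = X u s.
Proof.
move=> Jt; have [U [G [oU Ut /(_ 1%N)[dG _] GE]]] := X_smooth (x := (u, t)) Jt.
exists (fun s => G (u, s)).
  by have [] := is_derive_slice2 (derivableP (diff_derivable (dG _ Ut))).
have [[A B] /= [Au Bt] ABU] : nbhs (u, t) U by exact: open_nbhs_nbhs.
near=> s => Js; apply: GE => //; apply: ABU; split => /=.
  exact: nbhs_singleton.
by near: s.
Unshelve. all: by end_near. Qed.

End Slices.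

Section DerivWithin.
Context {R : realType} {W : normedModType R}.
Variable (J : set R).
Hypothesis J_interval : is_interval J.

Lemma within_dnbhs_proper (t t' : R) : J t -> J t' -> t' != t ->
  ProperFilter (within J t^').
Proof.
move=> Jt Jt' tt'; apply: Build_ProperFilter_ex => P [e /= e0 eP].
pose r := Num.min (e / 2) `|t' - t|.
have r0 : 0 < r by rewrite lt_min normr_gt0 subr_eq0 tt'; lra.
have re : r < e by rewrite gt_min; apply/orP; left; lra.
have rt : r <= `|t' - t| by rewrite ge_min lexx orbT.
have [lt|ge] := ltP t t'.
  rewrite gtr0_norm ?subr_gt0// in rt.
  exists (t + r); apply: eP.
  - by rewrite /= opprD addNKr normrN gtr0_norm.
  - by apply/eqP; lra.
  - by apply: (J_interval Jt Jt'); apply/andP; split; lra.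
rewrite ler0_norm ?subr_le0// in rt.
exists (t - r); apply: eP.
- by rewrite /= opprB addrC subrK gtr0_norm.
- by apply/eqP; lra.
- by apply: (J_interval Jt' Jt); apply/andP; split; lra.
Qed.

(** The points of J other than t accumulate at t, so the limit defining
    [deriv_within] is unique. *)
Lemma deriv_withinE (t t' : R) (c g : R -> W) d : J t -> J t' -> t' != t ->
  is_derive t 1 c d -> (\forall s \near t, J s -> c s = g s) ->
  deriv_within J g t = d.
Proof.
move=> Jt Jt' tt' [ct <-] cg.
have PF := within_dnbhs_proper Jt Jt' tt'.
apply: cvg_lim => //.
have : (s - t)^-1 *: (c s - c t) @[s --> t^'] --> 'D_1 c t.
  move=> A /ct[e /= e0 eA]; exists e => //= s st sNt.
  have := eA (s - t); rewrite /= sub0r normrN distrC => /(_ st).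
  by rewrite subr_eq0 => /(_ sNt); rewrite [(s - t)%:A]mulr1 subrK.
move=> H.
have {}H : (s - t)^-1 *: (c s - c t) @[s --> within J t^'] --> 'D_1 c t.
  exact: cvg_within_filter.
apply: cvg_trans H; apply: near_eq_cvg.
have ctg : c t = g t by exact: (nbhs_singleton cg).
rewrite near_withinE; near=> s => Js.
rewrite ctg; congr (_ *: (_ - _)).
by move: Js; near: s; exact: nbhs_dnbhs.
Unshelve. all: by end_near. Qed.

End DerivWithin.

(** * Regularity of the data *)

Lemma Ck_pred {R : realType} {V W : normedModType R} k (U : set V)
    (g : V -> W) :
  Ck k.+1 U g -> Ck k U g.
Proof.
elim: k g => [|k IH] g [dg Dg].
  by move=> x Ux; exact/differentiable_continuous/dg.
by split=> // v; exact/IH/Dg.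
Qed.

Section RealFunctions.
Context {R : realType}.
Implicit Types h : R -> R.

Lemma smooth_derivable h :
  smooth_on [set: R] h -> forall x : R, derivable h x 1.
Proof.
move=> hs x; have [U [g [oU Ux /(_ 1%N)[dg _] gE]]] := hs x I.
apply: (@near_eq_derivable _ _ _ g).
  by near=> y; apply: gE => //; near: y; exact: open_nbhs_nbhs.
exact/diff_derivable/dg.
Unshelve. all: by end_near. Qed.

(** Caratheodory's slope function k, with h y = k y * y, is continuous: at 0
    by differentiability of h, elsewhere as the quotient of h by the identity.
    Its maximum on [-B, B] is the constant. *)
Lemma linear_growth h B : (forall x : R, derivable h x 1) -> h 0 = 0 ->
  exists2 L, 0 <= L & forall y, `|y| <= B -> `|h y| <= L * `|y|.
Proof.
move=> dh h0.
have /is_derive1_caratheodory[k [+ k0 _]] := derivableP (dh 0).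
rewrite h0 => kE; have {}kE z : h z = k z * z by have := kE z; rewrite !subr0.
have ck : continuous k.
  move=> x; have [->//|x0] := eqVneq x 0.
  have : (fun y => h y / y) y @[y --> x] --> (h x / x).
    apply: cvgM; last exact: cvgV.
    exact/differentiable_continuous/derivable1_diffP.
  rewrite kE mulfK//; apply: cvg_trans; apply: near_eq_cvg.
  near=> y; rewrite kE mulfK//; near: y.
  exact: (open_nbhs_nbhs (conj (@open_neq _ 0) x0)).
have [B0|B0] := ltP B 0.
  by exists 0 => // y yB; have := le_lt_trans yB B0; rewrite normr_lt0.
have [||c _ cmax] := @EVT_max _ (fun y => `|k y|) (- B) B.
  by rewrite ge0_cp.
  apply: continuous_subspaceT => x; apply: continuous_comp (ck x) _.
  exact: norm_continuous.
exists `|k c| => // y yB; rewrite kE normrM ler_wpM2r//.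
by apply: cmax; rewrite in_itv/= -ler_norml.
Unshelve. all: by end_near. Qed.

End RealFunctions.

(** * A function restricted to a curve *)

Section FunctionAlongCurve.
Context {R : realType} {n : nat}.
Variables (f : 'cV[R]_n -> R) (c : R -> 'cV[R]_n).
Hypothesis f_C2 : Ck 2 [set: 'cV[R]_n] f.
Hypothesis dc : forall u : R, derivable c u 1.
Hypothesis ddc : forall u : R, derivable (derive1 c) u 1.
Hypothesis c_immersed : forall u, 0 < enorm (derive1 c u).

Lemma is_derive_value_along (u : R) :
  is_derive u 1 (f \o c)
    (enorm (derive1 c u) * dotv (grad f (c u)) (tangent c u)).
Proof.
have [df _] := f_C2.
rewrite -dotvZr -derive1_tangent// derive1E.
by apply: is_derive_along; [exact: derivableP|exact: df].
Qed.

(** In terms of arc length this is the formula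
    d^2 f(c)/ds^2 = T^T (hess f) T + grad f . dT/ds, and the first term is the
    one that the force is designed to reproduce. *)
Lemma is_derive_tangential_slope (u : R) :
  is_derive u 1 (fun v => dotv (grad f (c v)) (tangent c v))
    (enorm (derive1 c u) *
      (dotv ((hess f (c u))^T *m tangent c u) (tangent c u)
       + dotv (grad f (c u)) (arcderiv c (tangent c) u))).
Proof.
have [_ ddf] := f_C2.
have q0 : enorm (derive1 c u) != 0 by rewrite gt_eqF.
have dT := derivableP (derivable_tangent c_immersed ddc (u := u)).
have dgrad := is_derive_grad_along (derivableP (@dc u))
  (fun v => (ddf v).1 (c u) I).
apply: (is_derive_eq (is_derive_dotv dgrad dT)).
rewrite mulrDr -dotvZl -dotvZr; congr (_ + _); congr dotv.
  by rewrite -derive1E {1}derive1_tangent// scalemxAr.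
by rewrite {1}/arcderiv scalerA divff// scale1r (derive1E (tangent c)).
Qed.

End FunctionAlongCurve.

(** * The level of the evolving curves *)

Section ConstrainedFlow.
Context {R : realType} {n : nat}.
Variables (f : 'cV[R]_n -> R) (h : R -> R) (a : 'cV[R]_n -> 'cV[R]_n -> R).
Variables (J : set R) (X : R -> R -> 'cV[R]_n) (alpha : R -> R -> R).
Local Notation T u t := (tangent (X^~ t) u) (only parsing).
Local Notation F := (force f h a).
Hypothesis f_C2 : Ck 2 [set: 'cV[R]_n] f.
Hypothesis h_smooth : smooth_on [set: R] h.
Hypothesis h0 : h 0 = 0.
Hypothesis a_pos : forall x p, enorm p = 1 -> 0 < a x p.
Hypothesis a_bounded : exists C, forall x p, enorm p = 1 -> a x p <= C.
Hypothesis J_interval : is_interval J.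
Hypothesis J_ge0 : forall t, J t -> 0 <= t.
Hypothesis J_0 : J 0.
Hypothesis J_nontrivial : exists t, J t /\ 0 < t.
Hypothesis X_periodic : forall u t, J t -> X (u + 1) t = X u t.
Hypothesis X_smooth : smooth_on [set p : R * R | J p.2] (fun p => X p.1 p.2).
Hypothesis X_immersed : forall u t, J t -> 0 < enorm (derive1 (X^~ t) u).
Hypothesis grad_neq0 : forall u t, J t -> grad f (X u t) <> 0.
Hypothesis evolution : forall u t, J t ->
  deriv_within J (X u) t =
    a (X u t) (T u t) *: arcderiv (X^~ t) (tangent (X^~ t)) u
    + F (X u t) (T u t) + alpha u t *: T u t.
Hypothesis initial : forall u, f (X u 0) = 0.

Lemma J_other t : J t -> exists2 s, J s & s != t.
Proof.
move=> Jt; have [s [Js s0]] := J_nontrivial.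
have [->|t0] := eqVneq t 0; last by exists 0; rewrite // eq_sym.
by exists s => //; rewrite gt_eqF.
Qed.

Lemma derivable_space_slice t : J t -> (forall u : R, derivable (X^~ t) u 1) /\
  (forall u : R, derivable (derive1 (X^~ t)) u 1).
Proof. by move=> Jt; split=> u; have [] := smooth_slice1 X_smooth u Jt. Qed.

(** The parabolic equation d phi/dt = a d^2 phi/ds^2 + a h(phi) + alpha d phi/ds
    for phi = f(X), with all derivatives of phi expanded: the Hessian part of
    the force completes grad f . dT/ds to a second arc-length derivative. *)
Lemma level_evolution u t : J t ->
  dotv (grad f (X u t)) (deriv_within J (X u) t) =
  a (X u t) (T u t) *
    (dotv ((hess f (X u t))^T *m T u t) (T u t)
     + dotv (grad f (X u t)) (arcderiv (X^~ t) (tangent (X^~ t)) u))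
  + a (X u t) (T u t) * h (f (X u t))
  + alpha u t * dotv (grad f (X u t)) (T u t).
Proof.
move=> Jt; rewrite evolution// !dotvDr dotv_grad_force; last exact: grad_neq0.
by rewrite !dotvZr; ring.
Qed.

Lemma level_time_derivative u t : J t -> exists2 th : R -> R,
  is_derive t 1 th (dotv (grad f (X u t)) (deriv_within J (X u) t)) &
  \forall s \near t, J s -> th s = f (X u s).
Proof.
move=> Jt; have [c dc cX] := smooth_slice2 X_smooth u Jt.
have [s Js st] := J_other Jt.
exists (f \o c); last by apply: filterS cX => r /[apply] /= ->.
have ct : c t = X u t by exact: (nbhs_singleton cX).
rewrite -ct (deriv_withinE J_interval Jt Js st (derivableP dc) cX).
by apply: is_derive_along; [exact: derivableP|exact: f_C2.1].
Qed.

(** The equation for phi is treated for both signs [sg] = 1, -1 at once.  At a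
    positive maximum of sg * phi the transport term vanishes and the diffusion
    term is nonpositive, so only the reaction term a sg h(phi) is left; it is at
    most C L (sg * phi), where L is the growth constant of h on the range of the
    level up to time t0. *)
Lemma signed_level_le0 (sg : R) : `|sg| = 1 ->
  forall u t, J t -> sg * f (X u t) <= 0.
Proof.
move=> sg1 u0 t0 Jt0.
have sub (t : R) : 0 <= t <= t0 -> J t by exact: J_interval.
have t0_ge0 := J_ge0 Jt0.
have cphi : {within `[0, 1] `*` `[0, t0],
    continuous (fun p : R * R => f (X p.1 p.2))}.
  apply: (@within_continuous_comp _ _ _ _ (fun p : R * R => X p.1 p.2) f).
    by move=> x _; apply: differentiable_continuous; exact: f_C2.1.
  apply: continuous_subspaceW (smooth_on_within_continuous X_smooth).
  by move=> p [_] /=; rewrite in_itv/= => /sub.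
have [B phiB] : exists B, forall u t, 0 <= t <= t0 -> `|f (X u t)| <= B.
  have box0 : (`[0, 1] `*` `[0, t0] : set (R * R)) !=set0.
    by exists (0, 0); rewrite /= !in_itv/= !lexx ler01.
  have boxc := compact_setX (@segment_compact R 0 1) (@segment_compact R 0 t0).
  pose phi (p : R * R) := f (X p.1 p.2).
  have [|p _ pmax] := @compact_EVT_max _ _ (fun p => `|phi p|) _ box0 boxc.
    apply: (@within_continuous_comp _ _ _ _ phi Num.norm) => //.
    by move=> x _; exact: norm_continuous.
  exists `|phi p| => u t tI.
  have per : periodic (fun v => f (X v t)) 1.
    by move=> v; rewrite X_periodic//; exact: sub.
  have [v vI /= <-] := periodic_unit_interval u per.
  by apply: (pmax (v, t)); rewrite inE/= !in_itv.
have [L L0 hL] := linear_growth B (smooth_derivable h_smooth) h0.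
have [C aC] := a_bounded.
apply: (@weak_maximum_principle _ (fun u t => sg * f (X u t)) t0 (C * L));
  last 1 first.
- by rewrite t0_ge0 lexx.
- by move=> t /sub Jt u /=; rewrite X_periodic.
- by move=> p; apply: continuousM; [exact: cst_continuous|exact: cphi].
- by move=> u; rewrite initial mulr0.
move=> u t /andP[t_gt0 tt0] phi_gt0 phi_max.
have Jt : J t by apply: sub; rewrite ltW.
have [th dth thX] := level_time_derivative u Jt.
exists (fun s => sg * th s),
  (sg * dotv (grad f (X u t)) (deriv_within J (X u) t)).
split.
- exact: is_deriveZ.
- apply: filterS thX => s sX /andP[s0 st]; rewrite sX//.
  by apply: sub; rewrite s0 (le_trans st).
have [dX ddX] := derivable_space_slice Jt.
have im v := X_immersed v Jt.
have dphi (v : R) := is_deriveZ sg (is_derive_value_along f_C2 dX im v).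
have dpsi := is_deriveZ sg (is_derive_tangential_slope f_C2 dX ddX im u).
have [slope0 curv] := max_first_second_order
  (fun v => is_derive_eq (dphi v) (mulrCA _ _ _)) im dpsi phi_max.
have T1 : enorm (T u t) = 1 by exact: enorm_tangent.
have {}curv : sg * (dotv ((hess f (X u t))^T *m T u t) (T u t)
    + dotv (grad f (X u t)) (arcderiv (X^~ t) (tangent (X^~ t)) u)) <= 0.
  by move: curv; rewrite /GRing.scale/= mulrCA pmulr_rle0.
rewrite level_evolution// mulrDr (mulrCA _ (alpha u t)) slope0 mulr0 addr0.
rewrite mulrDr (mulrCA sg) [X in _ + X]mulrCA.
have reaction : sg * h (f (X u t)) <= L * (sg * f (X u t)).
  rewrite -(gtr0_norm phi_gt0) normrM sg1 mul1r.
  rewrite (le_trans (ler_norm _))// normrM sg1 mul1r hL// phiB//.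
  by rewrite tt0 ltW.
rewrite -[leRHS]add0r lerD//.
  by rewrite pmulr_rle0 ?a_pos.
rewrite (le_trans (ler_wpM2l (ltW (a_pos _ T1)) reaction))//.
rewrite [leLHS]mulrA ler_pM2r//.
by rewrite ler_wpM2r// aC.
Qed.

Lemma flow_stays_on_level u t : J t -> f (X u t) = 0.
Proof.
move=> Jt; apply/eqP; rewrite eq_le.
have := signed_level_le0 (normr1 R) u Jt.
have := signed_level_le0 (etrans (normrN 1) (normr1 R)) u Jt.
by rewrite mulN1r oppr_le0 mul1r => -> ->.
Qed.

(** The level vanishes identically, so its derivative along the curve does too:
    grad f, hence the force, is orthogonal to the tangent. *)
Lemma tangential_velocityE u t : J t -> tangential_velocity J X u t = alpha u t.
Proof.
move=> Jt; have im v := X_immersed v Jt.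
have [dX ddX] := derivable_space_slice Jt.
have slope0 : dotv (grad f (X u t)) (T u t) = 0.
  have [_] := is_derive_value_along f_C2 dX im u.
  rewrite (_ : f \o _ = cst (0 : R)); last first.
    by apply/funext => v /=; rewrite flow_stays_on_level.
  rewrite derive_cst => /esym/eqP.
  by rewrite mulf_eq0 gt_eqF//= => /eqP.
rewrite /tangential_velocity evolution// !dotvDl.
rewrite (dotvZl (a _ _)) curvature_orthogonal// (dotvZl (alpha u t)).
rewrite /force dotvZl slope0 !mulr0 !add0r.
by rewrite -sqr_enorm enorm_tangent// expr1n mulr1.
Qed.

End ConstrainedFlow.

Theorem theorem1 (R : realType)
  (f : 'cV[R]_3 -> R) (h : R -> R) (a : 'cV[R]_3 -> 'cV[R]_3 -> R)
  (* time interval of existence *)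
  (J : set R) (X : R -> R -> 'cV[R]_3) (alpha : R -> R -> R)
  (M := [set x : 'cV[R]_3 | f x = 0])
  (unit_bundle := [set q : 'cV[R]_3 * 'cV[R]_3 | enorm q.2 = 1])
  (domain := [set p : R * R | J p.2])
  (F := force f h a)
  (T := fun u t => tangent (X^~ t) u)
  (f_C4 : Ck 4 [set: 'cV[R]_3] f)
  (f_regular : forall x, M x -> grad f x <> 0)
  (h_smooth : smooth_on [set: R] h)
  (h0 : h 0 = 0)
  (a_pos : forall x p, unit_bundle (x, p) -> 0 < a x p)
  (a_bounded : exists C, forall x p, unit_bundle (x, p) -> a x p <= C)
  (a_smooth : smooth_on unit_bundle (fun q => a q.1 q.2))
  (J_interval : is_interval J)
  (J_ge0 : forall t, J t -> 0 <= t)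
  (J_0 : J 0)
  (J_nontrivial : exists t, J t /\ 0 < t)
  (X_periodic : forall u t, J t -> X (u + 1) t = X u t)
  (X_smooth : smooth_on domain (fun p => X p.1 p.2))
  (X_immersed : forall u t, J t -> 0 < enorm (derive1 (X^~ t) u))
  (alpha_periodic : forall u t, J t -> alpha (u + 1) t = alpha u t)
  (alpha_smooth : smooth_on domain (fun p => alpha p.1 p.2))
  (grad_neq0 : forall u t, J t -> grad f (X u t) <> 0)
  (F_bounded : exists C, forall u t, J t -> enorm (F (X u t) (T u t)) <= C)
  (F_smooth : smooth_on domain (fun p => F (X p.1 p.2) (T p.1 p.2)))
  (evolution : forall u t, J t ->
     deriv_within J (X u) t =
       a (X u t) (T u t) *: arcderiv (X^~ t) (arcderiv (X^~ t) (X^~ t)) u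
       + F (X u t) (T u t) + alpha u t *: arcderiv (X^~ t) (X^~ t) u)
  (initial : trace X 0 `<=` M) :
  (forall t, J t -> 0 < t -> trace X t `<=` M) /\
  (forall u t, J t -> tangential_velocity J X u t = alpha u t).
Proof.
have a_pos' x p : enorm p = 1 -> 0 < a x p by move=> p1; exact: a_pos.
have a_bounded' : exists C, forall x p, enorm p = 1 -> a x p <= C.
  by have [C aC] := a_bounded; exists C => x p p1; exact: aC.
have f_C2 : Ck 2 [set: 'cV[R]_3] f.
  by do 2!apply: Ck_pred.
have on_level u : f (X u 0) = 0 by apply: initial; exists u.
split=> [t Jt _ _ [u _ <-]|u t Jt].
  exact: (flow_stays_on_level f_C2 h_smooth h0 a_pos' a_bounded'
    J_interval J_ge0 J_0 J_nontrivial X_periodic X_smooth X_immersed grad_neq0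
    evolution on_level).
exact: (tangential_velocityE f_C2 h_smooth h0 a_pos' a_bounded'
    J_interval J_ge0 J_0 J_nontrivial X_periodic X_smooth X_immersed grad_neq0
    evolution on_level).
Qed.
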